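(* Let $(Y,X^{T})^{T}$ be a random vector in $\mathbb{R}\times\mathbb{R}^p$ with $E[Y^4]<\infty$ and $E[X_i^4]<\infty$ for $i=1,\dots,p$, with means $\mu_Y,\mu_X$, variance $\sigma_Y^2=\mathrm{Var}[Y]$, nonsingular covariance matrix $\Sigma_{XX}=\mathrm{Cov}[X,X]$, and $\Sigma_{YX}=\Sigma_{XY}^{T}=\mathrm{Cov}[Y,X]\neq 0$ (a $1\times p$ row vector). Let $\gamma=+\sqrt{\Sigma_{YX}\Sigma_{XX}^{-1}\Sigma_{XY}/\sigma_Y^2}$. Let $\mathcal{H}_{LP}$ be the class of functions $\tilde Y:\mathbb{R}^p\to\mathbb{R}$ of the form $\tilde Y(x)=\alpha+\beta x$ with $\alpha\in\mathbb{R}$ and $\beta$ a $1\times p$ row vector. Then there is a unique $\tilde Y^\star\in\mathcal{H}_{LP}$ such that $$\mathrm{CCC}[Y,\tilde Y^\star(X)]=\sup_{\tilde Y\in\mathcal{H}_{LP}}\mathrm{CCC}[Y,\tilde Y(X)],$$ and it is given by $$\tilde Y^\star(x_0)=\mu_Y+\frac{1}{\gamma}\,\Sigma_{YX}\Sigma_{XX}^{-1}(x_0-\mu_X),\qquad x_0\in\mathbb{R}^p.$$ Moreover, the maximum value is $\mathrm{CCC}[Y,\tilde Y^\star(X)]=\gamma$.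
   Context: For square-integrable random variables $Y$ and $Z$, Lin's concordance correlation coefficient is $$\mathrm{CCC}[Y,Z]=\frac{2\,\mathrm{Cov}[Y,Z]}{\mathrm{Var}[Y]+\mathrm{Var}[Z]+(E[Y]-E[Z])^2}.$$ The function $\tilde Y^\star$ is called the maximum agreement linear predictor (MALP). *)

(* Defs.v *)
From HB Require Import structures.
From mathcomp Require Import all_boot all_order all_algebra.
From mathcomp Require Import all_classical all_reals all_analysis.

Set Implicit Arguments.
Unset Strict Implicit.
Unset Printing Implicit Defensive.

Import Order.TTheory GRing.Theory Num.Theory.

Local Open Scope classical_set_scope.
Local Open Scope ring_scope.

(* The library's moments take values in [\bar R]; [fine] sends infinite values
   to 0, so the real-valued moments below are the usual ones only for
   square-integrable arguments. *)
Section Moments.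
Context (d : measure_display) (T : measurableType d) (R : realType).
Variable P : probability T R.

Definition mean (Z : T -> R) : R := fine 'E_P[Z].

Definition cov (Y Z : T -> R) : R := fine (covariance P Y Z).

Definition var (Z : T -> R) : R := fine 'V_P[Z].

Definition CCC (Y Z : T -> R) : R :=
  2 * cov Y Z / (var Y + var Z + (mean Y - mean Z) ^+ 2).

Definition coord_fun (p : nat) (X : T -> 'cV[R]_p) (i : 'I_p) : T -> R :=
  fun w => X w i 0.

Definition mean_vec (p : nat) (X : T -> 'cV[R]_p) : 'cV[R]_p :=
  \col_i mean (coord_fun X i).

Definition cov_mx (p : nat) (X : T -> 'cV[R]_p) : 'M[R]_p :=
  \matrix_(i, j) cov (coord_fun X i) (coord_fun X j).

Definition cov_row (p : nat) (Y : T -> R) (X : T -> 'cV[R]_p) : 'rV[R]_p :=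
  \row_j cov Y (coord_fun X j).

End Moments.

Definition linear_predictors (R : realType) (p : nat) : set ('cV[R]_p -> R) :=
  [set f | exists (alpha : R) (beta : 'rV[R]_p),
             forall x, f x = alpha + (beta *m x) 0 0].

(* The supremum is taken in [\bar R] because the real-valued [sup] has a junk
   value on unbounded sets. *)
Definition attains_max_CCC (d : measure_display) (T : measurableType d)
    (R : realType) (P : probability T R) (p : nat)
    (Y : T -> R) (X : T -> 'cV[R]_p) (f : 'cV[R]_p -> R) : Prop :=
  (CCC P Y (f \o X))%:E =
  ereal_sup [set (CCC P Y (h \o X))%:E | h in @linear_predictors R p].

(* Main.v *)
Require Import Defs.
From HB Require Import structures.
From mathcomp Require Import all_boot all_order all_algebra.
From mathcomp Require Import all_classical all_reals all_analysis.
From mathcomp Require Import ring.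

Set Implicit Arguments.
Unset Strict Implicit.
Unset Printing Implicit Defensive.

Import Order.TTheory GRing.Theory Num.Theory.

Local Open Scope classical_set_scope.
Local Open Scope ring_scope.

(** A linear predictor [Z = alpha + beta X] has [Cov[Y, Z] = <b0, beta>] and
    [Var[Z] = <beta, beta>] for the inner product [<u, v> = u SXX v^T], where
    [b0 = SYX SXX^-1]. As [gamma^2 sigma_Y^2 = <b0, b0>], completing the square
    gives, with [D] the denominator of [CCC[Y, Z]],
    [gamma D - 2 Cov[Y, Z]
       = gamma (|beta - b0 / gamma|^2 + (mu_Y - E[Z])^2)],
    which is nonnegative and vanishes only for [beta = b0 / gamma] and
    [E[Z] = mu_Y]. *)

Section Moments.
Context (d : measure_display) (T : measurableType d) (R : realType).
Variable P : probability T R.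
Implicit Types Y Z : T -> R.

(** The measure is finite, so L^4 lies in L^2. This turns the fourth-moment hypotheses into the
    square integrability on which the moment lemmas below rest. *)
Lemma Lfun2_of_fourth_moment Z : measurable_fun [set: T] Z ->
  ('E_P[(fun w => Z w ^+ 4)%R] < +oo)%E -> Z \in Lfun P 2%:E.
Proof.
move=> mZ Z4.
apply: (@Lfun_subset _ _ _ P 2%:E 4%:E); rewrite ?lee1n ?lee_fin ?ler_nat//.
  exact: fin_num_measure.
rewrite inE; apply/andP; split; rewrite inE//=.
rewrite /finite_norm unlock poweR_lty//.
move: Z4; rewrite unlock; apply: le_lt_trans.
(* The two integrands coincide: [|Z|^4 = Z^4] because the exponent is even. *)
rewrite le_eqVlt; apply/orP; left; apply/eqP; apply: eq_integral => x _ /=.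
by rewrite powR_mulrn// -normrX ger0_norm// (exprM _ 2 2) sqr_ge0.
Qed.

Lemma Lfun2_Lfun1 Z : Z \in Lfun P 2%:E -> Z \in Lfun P 1.
Proof. by apply: Lfun_subset12; exact: fin_num_measure. Qed.

Lemma Lfun2D Y Z : Y \in Lfun P 2%:E -> Z \in Lfun P 2%:E ->
  Y \+ Z \in Lfun P 2%:E.
Proof. by move=> Y2 Z2; rewrite rpredD ?lee1n. Qed.

Lemma cov_fin_num Y Z : Y \in Lfun P 2%:E -> Z \in Lfun P 2%:E ->
  covariance P Y Z \is a fin_num.
Proof.
by move=> Y2 Z2; rewrite covariance_fin_num ?Lfun2_mul_Lfun1 ?Lfun2_Lfun1.
Qed.

Lemma covC Y Z : cov P Y Z = cov P Z Y.
Proof. by rewrite /cov covarianceC. Qed.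

(** The shape [a + (c * Z + Z')] is one step of the induction on the list of coordinates: [Z] is the
    head coordinate and [Z'] the remaining sum. *)
Lemma cov_affine Y a c Z (Z' : T -> R) :
  Y \in Lfun P 2%:E -> Z \in Lfun P 2%:E -> Z' \in Lfun P 2%:E ->
  cov P Y (fun w => a + (c * Z w + Z' w)) = c * cov P Y Z + cov P Y Z'.
Proof.
move=> Y2 Z2 Z'2.
have -> : (fun w => a + (c * Z w + Z' w)) = (cst a \+ (c \o* Z \+ Z')).
  by apply/funext => w /=; rewrite (mulrC (Z w)).
have cZ2 : c \o* Z \in Lfun P 2%:E by rewrite Lfun_scale ?ler1n.
rewrite /cov covarianceDr ?Lfun_cst//; last exact: Lfun2D.
rewrite covariance_cst_r add0e covarianceDr//.
rewrite covarianceZr ?Lfun2_mul_Lfun1 ?Lfun2_Lfun1//.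
by rewrite fineD ?fin_numM ?fineM ?cov_fin_num.
Qed.

Lemma mean_affine a c Z (Z' : T -> R) :
  Z \in Lfun P 2%:E -> Z' \in Lfun P 2%:E ->
  mean P (fun w => a + (c * Z w + Z' w)) = a + (c * mean P Z + mean P Z').
Proof.
move=> /Lfun2_Lfun1 Z1 /Lfun2_Lfun1 Z'1.
have -> : (fun w => a + (c * Z w + Z' w)) = (cst a \+ (c \o* Z \+ Z')).
  by apply/funext => w /=; rewrite (mulrC (Z w)).
have cZ1 : c \o* Z \in Lfun P 1 by rewrite Lfun_scale.
rewrite /mean expectationD ?Lfun_cst ?rpredD//.
rewrite expectationD// expectationZl// expectation_cst.
by rewrite !fineD ?fin_numD ?fin_numM ?fineM ?expectation_fin_num.
Qed.

Lemma var_ge0 Z : 0 <= var P Z.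
Proof. by rewrite /var fine_ge0 ?variance_ge0. Qed.

(** By Cauchy-Schwarz the covariance of [Z] with any square-integrable [W] is at most 0; taking both
    [W = Y] and [W = - Y] gives equality. *)
Lemma var0_cov_eq0 Z Y : Z \in Lfun P 2%:E -> Y \in Lfun P 2%:E ->
  var P Z = 0 -> cov P Z Y = 0.
Proof.
move=> Z2 Y2 VZ0.
have {}VZ0 : 'V_P[Z] = 0%E.
  by rewrite -(fineK (variance_fin_num Z2)); move: VZ0; rewrite /var => ->.
have le0 W : W \in Lfun P 2%:E -> (covariance P Z W <= 0)%E.
  move=> W2; have := covariance_le Z2 W2.
  by rewrite VZ0 /= sqrtr0 mul0e.
apply/eqP; rewrite eq_le -!lee_fin /cov fineK ?cov_fin_num// le0//=.
have := le0 (\- Y); rewrite rpredN ?lee1n//.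
rewrite covarianceNr ?Lfun2_mul_Lfun1 ?Lfun2_Lfun1//.
by move=> /(_ Y2); rewrite oppe_le0.
Qed.

Section LinearCombinations.
Variables (p : nat) (X : T -> 'cV[R]_p).
Hypothesis X2 : forall i, coord_fun X i \in Lfun P 2%:E.

Definition lincomb (a : R) (b : 'rV[R]_p) : T -> R :=
  fun w => a + (b *m X w) 0 0.

Let combE a b (s := index_enum 'I_p) :
  lincomb a b = fun w => a + \sum_(i <- s) b 0 i * coord_fun X i w.
Proof. by apply/funext => w; rewrite /lincomb mxE. Qed.

(** The tail restarts with intercept 0 so that it is again an affine sum over a list; the inductions
    that use this step therefore generalize over [a]. *)
Let comb_step a (b : 'I_p -> R) i s :
  (fun w => a + \sum_(j <- i :: s) b j * coord_fun X j w) =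
  (fun w => a + (b i * coord_fun X i w +
                 (fun w => 0 + \sum_(j <- s) b j * coord_fun X j w) w)).
Proof. by apply/funext => w; rewrite big_cons add0r. Qed.

Let Lfun2_comb a (b : 'I_p -> R) s :
  (fun w => a + \sum_(i <- s) b i * coord_fun X i w) \in Lfun P 2%:E.
Proof.
elim: s a => [|i s IHs] a.
  rewrite (_ : (fun _ => _) = cst a) ?Lfun_cst//.
  by apply/funext => w /=; rewrite big_nil addr0.
rewrite comb_step [X in X \in _](_ : _ = (cst a \+ (b i \o* coord_fun X i \+
    (fun w => 0 + \sum_(j <- s) b j * coord_fun X j w)))).
  by rewrite Lfun2D ?Lfun_cst// Lfun2D ?Lfun_scale ?ler1n.
by apply/funext => w /=; rewrite (mulrC (coord_fun X i w)).
Qed.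

Lemma Lfun2_lincomb a b : lincomb a b \in Lfun P 2%:E.
Proof. by rewrite combE Lfun2_comb. Qed.

Lemma cov_lincombr Y a b : Y \in Lfun P 2%:E ->
  cov P Y (lincomb a b) = (cov_row P Y X *m b^T) 0 0.
Proof.
move=> Y2; rewrite combE mxE.
under [RHS]eq_bigr do rewrite !mxE mulrC.
elim: (index_enum _) a => [|i s IHs] a.
  rewrite big_nil (_ : (fun _ => _) = cst a) /cov ?covariance_cst_r//.
  by apply/funext => w /=; rewrite big_nil addr0.
by rewrite comb_step cov_affine// IHs big_cons.
Qed.

Lemma mean_lincomb a b : mean P (lincomb a b) = a + (b *m mean_vec P X) 0 0.
Proof.
rewrite combE mxE.
under [in RHS]eq_bigr do rewrite mxE.
elim: (index_enum _) a => [|i s IHs] a.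
  rewrite big_nil (_ : (fun _ => _) = cst a) /mean ?expectation_cst ?addr0//.
  by apply/funext => w /=; rewrite big_nil addr0.
by rewrite comb_step mean_affine// IHs big_cons add0r.
Qed.

Lemma cov_row_lincomb a b : cov_row P (lincomb a b) X = b *m cov_mx P X.
Proof.
apply/rowP => j; rewrite mxE covC cov_lincombr// !mxE.
by apply: eq_bigr => i _; rewrite !mxE mulrC covC.
Qed.

(** Variance unfolds to the covariance of a variable with itself, which is then expanded in each
    argument in turn. *)
Lemma var_lincomb a b :
  var P (lincomb a b) = (b *m cov_mx P X *m b^T) 0 0.
Proof.
by rewrite -(cov_row_lincomb a b) -(cov_lincombr a b) ?Lfun2_lincomb.
Qed.

Lemma cov_mx_sym : (cov_mx P X)^T = cov_mx P X.
Proof. by apply/matrixP => i j; rewrite !mxE covC. Qed.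

Lemma cov_form_ge0 (b : 'rV[R]_p) : 0 <= (b *m cov_mx P X *m b^T) 0 0.
Proof. by rewrite -(var_lincomb 0) var_ge0. Qed.

(** The form is the variance of [b X]. If it vanishes, [b X] has covariance 0 with every coordinate,
    so [b *m cov_mx P X = 0], and the matrix can be inverted. *)
Lemma cov_form_eq0 (b : 'rV[R]_p) : cov_mx P X \in unitmx ->
  (b *m cov_mx P X *m b^T) 0 0 = 0 -> b = 0.
Proof.
move=> Sunit; rewrite -(var_lincomb 0) => V0.
rewrite -(mulmxK Sunit b) -(cov_row_lincomb 0).
rewrite (_ : cov_row _ _ _ = 0) ?mul0mx//.
by apply/rowP => i; rewrite !mxE var0_cov_eq0// Lfun2_lincomb.
Qed.

(** This makes the denominator of the CCC positive for every predictor. *)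
Lemma cov_row_neq0_var_gt0 Y : Y \in Lfun P 2%:E ->
  cov_row P Y X != 0 -> 0 < var P Y.
Proof.
move=> Y2 s0; rewrite lt_def var_ge0 andbT; apply: contra s0 => /eqP V0.
by apply/eqP/rowP => i; rewrite !mxE var0_cov_eq0.
Qed.

End LinearCombinations.
End Moments.

(** Applied with [s = SYX], [S = SXX] and [g = gamma]. The outer factor [g] cancels the [g^-1] of
    the cross terms, leaving exactly the numerator [2 Cov[Y, Z]] of the CCC. *)
Lemma complete_square (R : fieldType) p (S : 'M[R]_p) (s b : 'rV[R]_p) (g : R) :
  S^T = S -> S \in unitmx -> g != 0 ->
  let c := b - g^-1 *: (s *m invmx S) in
  g * (c *m S *m c^T) 0 0 =
  g * (b *m S *m b^T) 0 0 - 2 * (s *m b^T) 0 0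
    + g^-1 * (s *m invmx S *m s^T) 0 0.
Proof.
move=> Ssym Sunit g0 /=.
set b0 := s *m invmx S.
have b0S : b0 *m S = s by rewrite mulmxKV.
(* Symmetry of [S] makes the two cross terms transposes of each other, hence equal as 1 x 1
   matrices. *)
have bs : b *m S *m b0^T = (s *m b^T)^T.
  by rewrite -mulmxA -{1}Ssym -trmx_mul b0S trmx_mul trmxK.
have -> : (b - g^-1 *: b0)^T = b^T - g^-1 *: b0^T by rewrite linearB linearZ.
rewrite mulmxBl -scalemxAl b0S mulmxBr !mulmxBl -!scalemxAl -!scalemxAr bs.
have -> : s *m b0^T = (b0 *m s^T)^T by rewrite [RHS]trmx_mul trmxK.
by rewrite !mxE; field.
Qed.

Theorem theorem1 (R : realType) (d : measure_display) (T : measurableType d)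
    (P : probability T R) (p : nat) (Y : T -> R) (X : T -> 'cV[R]_p)
    (mY : measurable_fun [set: T] Y)
    (mX : forall i : 'I_p, measurable_fun [set: T] (coord_fun X i))
    (Y4 : ('E_P[(fun w => Y w ^+ 4)%R] < +oo)%E)
    (X4 : forall i : 'I_p, ('E_P[(fun w => coord_fun X i w ^+ 4)%R] < +oo)%E) :
  let muY := mean P Y in
  let muX := mean_vec P X in
  let sigma2Y := var P Y in
  let SXX := cov_mx P X in
  let SYX := cov_row P Y X in
  let gamma := Num.sqrt ((SYX *m invmx SXX *m SYX^T) 0 0 / sigma2Y) in
  SXX \in unitmx ->
  SYX != 0 ->
  exists Ystar : 'cV[R]_p -> R,
    [/\ unique (fun f => linear_predictors f /\ attains_max_CCC P Y X f) Ystar,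
        forall x0 : 'cV[R]_p,
          Ystar x0 = muY + gamma^-1 * (SYX *m invmx SXX *m (x0 - muX)) 0 0
      & CCC P Y (Ystar \o X) = gamma].
Proof.
move=> muY muX sigma2Y SXX SYX gamma Sunit SYX0.
have Y2 := Lfun2_of_fourth_moment mY Y4.
have X2 i := Lfun2_of_fourth_moment (mX i) (X4 i).
have sigma0 : 0 < sigma2Y := cov_row_neq0_var_gt0 X2 Y2 SYX0.
pose b0 := SYX *m invmx SXX.
pose q := (b0 *m SYX^T) 0 0.
have b0S : b0 *m SXX = SYX by rewrite mulmxKV.
have qE : q = (b0 *m SXX *m b0^T) 0 0.
  rewrite b0S (_ : _ *m _ = (b0 *m SYX^T)^T) 1?[RHS]mxE//.
  by rewrite [RHS]trmx_mul trmxK.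
have q0 : 0 < q.
  rewrite lt_def qE cov_form_ge0// andbT; apply: contra SYX0 => /eqP.
  by move=> /(cov_form_eq0 X2 Sunit) b00; rewrite -b0S b00 mul0mx.
have gamma0 : 0 < gamma by rewrite sqrtr_gt0 divr_gt0.
(* The constant left over from completing the square is thus the share of [Var[Y]] in [gamma] times
   the denominator. *)
have gammaq : gamma^-1 * q = gamma * sigma2Y.
  have : gamma ^+ 2 = q / sigma2Y by rewrite sqr_sqrtr// ltW// divr_gt0.
  move=> /(congr1 ( *%R^~ sigma2Y)); rewrite divfK ?gt_eqF// => <-.
  by field; rewrite gt_eqF.
pose den (a : R) (b : 'rV[R]_p) :=
  sigma2Y + var P (lincomb X a b) + (muY - mean P (lincomb X a b)) ^+ 2.
have den0 a b : 0 < den a b.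
  by rewrite /den -addrA ltr_wpDr// addr_ge0 ?var_ge0 ?sqr_ge0.
(* The bracket of the completed square: the CCC falls short of [gamma] by [gamma * defect / den]. *)
pose defect (a : R) (b : 'rV[R]_p) := let c := b - gamma^-1 *: b0 in
  (c *m SXX *m c^T) 0 0 + (muY - mean P (lincomb X a b)) ^+ 2.
have CCCE a b : CCC P Y (lincomb X a b) = gamma - gamma * defect a b / den a b.
  apply: (mulIf (lt0r_neq0 (den0 a b))).
  have -> : CCC P Y (lincomb X a b) =
      2 * cov P Y (lincomb X a b) / den a b by [].
  rewrite mulrBl !divfK ?lt0r_neq0// /defect /= [X in _ - X]mulrDr.
  rewrite (complete_square SYX b (cov_mx_sym P X) Sunit (lt0r_neq0 gamma0)).
  by rewrite -/b0 -/q gammaq cov_lincombr// /den var_lincomb//; ring.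
have defect_ge0 a b : 0 <= defect a b.
  by rewrite addr_ge0 ?cov_form_ge0 ?sqr_ge0.
have CCC_le a b : CCC P Y (lincomb X a b) <= gamma.
  by rewrite CCCE gerBl divr_ge0 ?mulr_ge0 ?defect_ge0// ltW.
(* With slope [gamma^-1 *: b0], this intercept gives the predictor mean [muY], so both terms of
   [defect] vanish. *)
pose a0 := muY - gamma^-1 * (b0 *m muX) 0 0.
have scaleE (x : 'cV[R]_p) :
    ((gamma^-1 *: b0) *m x) 0 0 = gamma^-1 * (b0 *m x) 0 0.
  by rewrite -scalemxAl mxE.
pose Ystar (x : 'cV[R]_p) := a0 + ((gamma^-1 *: b0) *m x) 0 0.
have CCCstar : CCC P Y (Ystar \o X) = gamma.
  rewrite -[_ \o _]/(lincomb X a0 (gamma^-1 *: b0)) CCCE /defect mean_lincomb//.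
  rewrite scaleE /a0 subrK !subrr !mul0mx mxE.
  by rewrite expr0n addr0 mulr0 mul0r subr0.
have supE : ereal_sup [set (CCC P Y (h \o X))%:E | h in @linear_predictors R p]
    = gamma%:E.
  apply/eqP; rewrite eq_le; apply/andP; split.
    apply: ge_ereal_sup => _ [h [a [b hE]] <-].
    have -> : h \o X = lincomb X a b by apply/funext => w; rewrite /= hE.
    by rewrite lee_fin.
  apply: ereal_sup_ubound; exists Ystar; last by rewrite CCCstar.
  by exists a0, (gamma^-1 *: b0).
exists Ystar; split=> //.
- split.
    split; first by exists a0, (gamma^-1 *: b0).
    by rewrite /attains_max_CCC supE CCCstar.
  move=> f [[a [b fE]]]; rewrite /attains_max_CCC supE.
  have -> : f \o X = lincomb X a b by apply/funext => w; rewrite /= fE.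
  (* Reaching [gamma] forces [defect = 0]. Both of its summands are nonnegative, so each is 0: the
     first fixes the slope [b], the second then fixes the intercept [a]. *)
  move=> -[] /eqP; rewrite CCCE -subr_eq0 addrAC subrr add0r oppr_eq0.
  rewrite !mulf_eq0 invr_eq0 (gt_eqF gamma0) (gt_eqF (den0 a b)) orbF /=.
  rewrite paddr_eq0 ?cov_form_ge0 ?sqr_ge0// sqrf_eq0.
  move=> /andP[/eqP/(cov_form_eq0 X2 Sunit)/subr0_eq bE].
  rewrite mean_lincomb// bE => /eqP/subr0_eq muYE.
  by apply/funext => x; rewrite fE bE /Ystar /a0 muYE !scaleE addrK.
- move=> x; rewrite /Ystar scaleE /a0 mulmxBr.
  by rewrite [X in _ = _ + _ * X]mxE [X in _ + _ * (_ + X)]mxE; ring.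
Qed.
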